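(* For every connected graph $G$ that is $(P_6,C_6)$-free, $\gamma_c(G) \le \gamma(G) + 1$.
   Context: All graphs are finite and simple. A dominating set of a graph $G$ is a vertex subset $X$ such that every vertex not in $X$ has a neighbor in $X$; $\gamma(G)$ is the minimum size of a dominating set. A connected dominating set is a dominating set $X$ such that the induced subgraph $G[X]$ is connected; for connected $G$, $\gamma_c(G)$ is the minimum size of a connected dominating set. $P_k$ denotes the path on $k$ vertices and $C_k$ the cycle on $k$ vertices. $G$ is $(H_1,H_2)$-free if it contains neither $H_1$ nor $H_2$ as an induced subgraph. *)

(* Defs.v *)
From mathcomp Require Import all_boot.

Set Implicit Arguments.
Unset Strict Implicit.
Unset Printing Implicit Defensive.

(* A finite simple graph is a symmetric irreflexive relation e on a finType.  *)

Section Domination.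
Variables (T : finType) (e : rel T).

Definition dominating (X : {set T}) : bool :=
  [forall x, (x \notin X) ==> [exists y in X, e x y]].

Definition induced_rel (X : {set T}) : rel T :=
  [rel x y | [&& x \in X, y \in X & e x y]].

(* The empty set counts as connected; it dominates only the empty graph.      *)
Definition connected_set (X : {set T}) : bool :=
  [forall x in X, forall y in X, connect (induced_rel X) x y].

Definition connected_graph : bool := connected_set [set: T].

Definition connected_dominating (X : {set T}) : bool :=
  dominating X && connected_set X.

Definition gamma : nat := #|[arg min_(X < [set: T] | dominating X) #|X| ]|.

(* Meaningful only for a connected graph: the seed setT must itself be a      *)
(* connected dominating set.                                                  *)
Definition gamma_c : nat :=
  #|[arg min_(X < [set: T] | connected_dominating X) #|X| ]|.

Lemma dominatingT : dominating [set: T].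
Proof. by apply/forallP => x; rewrite inE. Qed.

Lemma gammaP :
  (exists2 X : {set T}, dominating X & #|X| = gamma) /\
  (forall X : {set T}, dominating X -> gamma <= #|X|).
Proof.
rewrite /gamma; case: arg_minnP => [|X domX minX]; first exact: dominatingT.
by split; first exists X.
Qed.

Lemma gamma_cP : connected_graph ->
  (exists2 X : {set T}, connected_dominating X & #|X| = gamma_c) /\
  (forall X : {set T}, connected_dominating X -> gamma_c <= #|X|).
Proof.
move=> conT; rewrite /gamma_c; case: arg_minnP => [|X domX minX].
  by rewrite /connected_dominating dominatingT.
by split; first exists X.
Qed.

End Domination.

Definition path_rel (k : nat) : rel 'I_k :=
  [rel i j : 'I_k | (i.+1 == j :> nat) || (j.+1 == i :> nat)].

(* This is the cycle C_k only for k >= 3.                                     *)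
Definition cycle_rel (k : nat) : rel 'I_k :=
  [rel i j : 'I_k | (i.+1 %% k == j :> nat) || (j.+1 %% k == i :> nat)].

Definition has_induced (S T : finType) (h : rel S) (e : rel T) : Prop :=
  exists2 f : S -> T, injective f & forall x y, e (f x) (f y) = h x y.

Definition induced_free (S T : finType) (h : rel S) (e : rel T) : Prop :=
  ~ has_induced h e.

(* Main.v *)
(** Among the pairs (C, R) with C connected and nonempty, C and R together
    dominating, and |C| + |R| <= gamma + 1, take one whose closed neighborhood
    N[C] is largest, and suppose N[C] is not everything. Call x in N[C] attached
    if it has a neighbor outside N[C]. By maximality such an x starts an induced
    path x - y - u with y, u outside N[C]. If x missed some c' in C, then
    exchanging c' for x, possibly together with moving a vertex from R next to x,
    would enlarge N[C]: every obstruction is an induced P_6 or C_6. Hence attached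
    vertices are complete to C. Now let D be a minimum dominating set. A vertex z
    of D in N[C] that is neither attached nor adjacent to x has a neighbor c in C,
    and N[z] lies in N[x] and N[c] together, again because w - z - c - x - y - u is
    not an induced P_6 or C_6. Replacing all such z by their c and adding x makes
    the part of D in N[C] connected at a cost of one vertex, and yields a pair with
    a larger N[C]. *)

Require Import Defs.
From mathcomp Require Import all_boot.

Set Implicit Arguments.
Unset Strict Implicit.
Unset Printing Implicit Defensive.

(** * Closed neighborhoods, connectivity criteria and the forbidden path *)

Section ClosedNeighborhood.
Variables (T : finType) (e : rel T).
Hypotheses (e_sym : symmetric e) (e_irr : irreflexive e).
Implicit Types (X Y : {set T}) (v x y : T).

Definition nbhd X : {set T} := [set v | (v \in X) || [exists y in X, e v y]].

Lemma nbhdP X v :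
  reflect (exists2 y, y \in X & (v == y) || e v y) (v \in nbhd X).
Proof.
rewrite inE; apply: (iffP orP) => [[vX|/existsP[y /andP[yX vy]]]|[y yX]].
- by exists v; rewrite ?eqxx.
- by exists y; rewrite ?vy ?orbT.
- case/orP=> [/eqP->|vy]; first by left.
  by right; apply/existsP; exists y; rewrite yX.
Qed.

Lemma sub_nbhd X v : v \in X -> v \in nbhd X.
Proof. by move=> vX; rewrite inE vX. Qed.

Lemma adj_nbhd X v y : y \in X -> e v y -> v \in nbhd X.
Proof. by move=> yX vy; apply/nbhdP; exists y; rewrite ?vy ?orbT. Qed.

Lemma nbhdS X Y : X \subset Y -> nbhd X \subset nbhd Y.
Proof.
move=> /subsetP XY; apply/subsetP => v /nbhdP[y yX vy].
by apply/nbhdP; exists y; rewrite ?XY.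
Qed.

Lemma dominating_nbhd X : dominating e X = (nbhd X == setT).
Proof.
apply/forallP/eqP => [dX|NX v].
  apply/setP => v; rewrite !inE; have := dX v.
  by case: (v \in X) => //= /existsP[y yX]; apply/existsP; exists y.
have: v \in nbhd X by rewrite NX inE.
by rewrite inE => /orP[->|->] //; rewrite implybT.
Qed.

Lemma connected_set_from x X :
  (forall z, z \in X -> connect (induced_rel e X) x z) -> connected_set e X.
Proof.
have sX: symmetric (induced_rel e X).
  by move=> u v; rewrite /induced_rel /= e_sym andbCA.
move=> cX; apply/forall_inP => u uX; apply/forall_inP => v vX.
by apply: connect_trans (cX v vX); rewrite (sym_connect_sym sX) cX.
Qed.

(** The connectivity test for the sets rebuilt around an attached vertex [x]. *)
Lemma connected_set_radius2 x X : x \in X ->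
  (forall z, z \in X -> z != x -> e x z \/ exists2 c, c \in X & e x c && e c z) ->
  connected_set e X.
Proof.
move=> xX rX; apply: (@connected_set_from x) => z zX.
have [->|zx] := eqVneq z x; first exact: connect0.
have [xz|[c cX /andP[xc cz]]] := rX z zX zx.
  by apply: connect1; rewrite /induced_rel /= xX zX.
apply: (@connect_trans _ _ c); apply: connect1; by rewrite /induced_rel /= ?xX ?cX ?zX.
Qed.

Lemma connected_set1 x : connected_set e [set x].
Proof.
by apply: (@connected_set_radius2 x); rewrite ?set11 // => z /set1P->; rewrite eqxx.
Qed.

Lemma connected_setU1 x c X :
  connected_set e X -> c \in X -> e x c -> connected_set e (x |: X).
Proof.
move=> /forall_inP cX cinX xc; apply: (@connected_set_from x) => z /setU1P[->|zX].
  exact: connect0.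
apply: (@connect_trans _ _ c).
  by apply: connect1; rewrite /induced_rel /= !inE eqxx cinX orbT.
have /forall_inP/(_ _ zX) := cX _ cinX.
apply: connect_sub => u v /and3P[uX vX uv].
by apply: connect1; rewrite /induced_rel /= !inE uX vX !orbT.
Qed.

Lemma connected_set_crossing X (S : {set T}) a b :
  connected_set e X -> a \in X -> b \in X -> a \in S -> b \notin S ->
  exists u v, [/\ u \in X, u \in S, v \in X, v \notin S & e u v].
Proof.
move=> /forall_inP cX aX bX aS bS.
have /forall_inP/(_ _ bX)/connectP[p] := cX _ aX.
elim: p a aX aS => [|z p IH] a aX aS /=; first by move=> _ eb; rewrite eb aS in bS.
case/andP=> /and3P[_ zX az] pp lb.
have [zS|zS] := boolP (z \in S); first exact: IH zX zS pp lb.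
by exists a, z.
Qed.

Hypotheses (P6_free : induced_free (@path_rel 6) e).
Hypotheses (C6_free : induced_free (@cycle_rel 6) e).

(* The adjacency of a and g is left open: this covers both P_6 and C_6. *)
Lemma no_P6_C6 a b c d f g :
  e a b -> e b c -> e c d -> e d f -> e f g ->
  ~~ e a c -> ~~ e a d -> ~~ e a f -> ~~ e b d -> ~~ e b f -> ~~ e b g ->
  ~~ e c f -> ~~ e c g -> ~~ e d g -> False.
Proof.
move=> ab bc cd df fg /negbTE ac /negbTE ad /negbTE af /negbTE bd /negbTE bf.
move=> /negbTE bg /negbTE cf /negbTE cg /negbTE dg.
(* Vertices are told apart by a vertex [w] adjacent to exactly one of them. *)
have neq u v w : e u w -> e v w = false -> u != v.
  by move=> uw vw; apply: contraTneq uw => ->; rewrite vw.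
have uniq6 : uniq [:: a; b; c; d; f; g].
  rewrite /= !inE !negb_or; do !(apply/andP; split) => //.
  - by apply: (neq _ _ b); rewrite ?e_irr.
  - by rewrite eq_sym; apply: (neq _ _ d).
  - by rewrite eq_sym; apply: (neq _ _ f).
  - by apply: (neq _ _ b); rewrite // e_sym.
  - by apply: (neq _ _ b); rewrite // e_sym.
  - by apply: (neq _ _ c); rewrite ?e_irr.
  - by apply: (neq _ _ a); rewrite e_sym.
  - by rewrite eq_sym; apply: (neq _ _ g).
  - by apply: (neq _ _ c); rewrite // e_sym.
  - by apply: (neq _ _ d); rewrite ?e_irr.
  - by apply: (neq _ _ b); rewrite e_sym.
  - by apply: (neq _ _ b); rewrite e_sym.
  - by apply: (neq _ _ f); rewrite ?e_irr.
  - by apply: (neq _ _ c); rewrite e_sym.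
  - by apply: (neq _ _ g); rewrite ?e_irr.
pose h (i : 'I_6) := nth a [:: a; b; c; d; f; g] i.
have inj_h : injective h.
  by move=> i j /eqP; rewrite /h nth_uniq // => /eqP/val_inj.
have [ag|/negbTE ag] := boolP (e a g); [apply: C6_free|apply: P6_free];
  exists h => // -[[|[|[|[|[|[|?]]]]]] ?] [[|[|[|[|[|[|?]]]]]] ?] //;
  by rewrite /h /= ?e_irr // e_sym.
Qed.

End ClosedNeighborhood.

(** * A maximal pair, and attached vertices complete to [C] *)

Section MaximalPair.
Variables (T : finType) (e : rel T).
Hypotheses (e_sym : symmetric e) (e_irr : irreflexive e).
Hypotheses (e_conn : connected_graph e).
Hypotheses (P6_free : induced_free (@path_rel 6) e).
Hypotheses (C6_free : induced_free (@cycle_rel 6) e).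

Local Notation N := (nbhd e).

Variables (k : nat) (C R : {set T}).
Hypotheses (C_conn : connected_set e C) (C_neq0 : C != set0).
Hypotheses (R_dom : forall v, v \notin N C -> v \in N R).
Hypotheses (CR_le : #|C| + #|R| <= k).
Hypothesis CR_max : forall C' R' : {set T},
  connected_set e C' -> (forall v, v \notin N C' -> v \in N R') ->
  #|C'| + #|R'| <= k -> N C \subset N C' -> N C' \subset N C.

Definition attached x := (x \in N C) && [exists y, (y \notin N C) && e x y].

Lemma attachedP x :
  reflect (x \in N C /\ exists2 y, y \notin N C & e x y) (attached x).
Proof.
apply: (iffP andP) => [[xC /existsP[y /andP[]]]|[xC [y yC xy]]].
  by split => //; exists y.
by split => //; apply/existsP; exists y; rewrite yC.
Qed.

Lemma not_attached_adj x y : x \in N C -> ~~ attached x -> y \notin N C -> ~~ e x y.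
Proof.
by move=> xC nx yC; apply: contra nx => xy; apply/attachedP; split=> //; exists y.
Qed.

Lemma outside_adj c y : c \in C -> y \notin N C -> ~~ e c y.
Proof. by move=> cC; apply: contra => cy; apply: (adj_nbhd cC); rewrite e_sym. Qed.

Lemma attached_nbr x : attached x -> exists2 c, c \in C & e x c.
Proof.
case/attachedP=> /nbhdP[c cC /orP[/eqP->|xc]] [y yC xy]; last by exists c.
by have := outside_adj cC yC; rewrite xy.
Qed.

Lemma attached_notin x : attached x -> x \notin C.
Proof.
case/attachedP=> _ [y yC xy]; apply/negP => xC.
by have := outside_adj xC yC; rewrite xy.
Qed.

Lemma no_growth (C' R' : {set T}) w :
  connected_set e C' -> N C \subset N C' ->
  (forall v, v \notin N C' -> v \in N R') ->
  #|C'| + #|R'| <= k -> w \notin N C -> w \in N C' -> False.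
Proof.
move=> cC' sub dom le wC wC'.
by have /subsetP/(_ _ wC') := CR_max cC' dom le sub; apply/negP.
Qed.

(** Dropping [r] from [R] pays for one more vertex in [C'], as long as [C'] covers all that [r]
    dominated outside [N C]. *)
Lemma no_swap (C' : {set T}) r w : r \in R ->
  connected_set e C' -> N C \subset N C' ->
  (forall v, v \notin N C -> (v == r) || e v r -> v \in N C') ->
  #|C'| <= #|C| + 1 -> w \notin N C -> w \in N C' -> False.
Proof.
move=> rR cC' sub dom le; apply: (@no_growth _ (R :\ r)) => //.
  move=> v vC'; have vC : v \notin N C by apply: contra vC'; apply/subsetP.
  have /nbhdP[s sR vs] := R_dom vC.
  apply/nbhdP; exists s; rewrite // !inE sR andbT.
  by apply: contra vC' => /eqP sr; apply: dom; rewrite -?sr.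
by apply: leq_trans CR_le; rewrite (cardsD1 r R) rR addnA leq_add2r.
Qed.

(** If [r] were in [N C], it would be attached through [y], hence adjacent to [C], and could move
    from [R] into [C]. *)
Lemma dominator_outside x y r : attached x -> y \notin N C -> e x y ->
  r \in R -> (y == r) || e y r -> r \notin N C.
Proof.
move=> ax yC xy rR yr; apply/negP => rC.
have ry : e y r by case/orP: yr => // /eqP yr; rewrite yr rC in yC.
have /attached_nbr[c cC rc]: attached r.
  by apply/attachedP; split => //; exists y; rewrite // e_sym.
apply: (@no_swap (r |: C) r y rR) => //.
- exact: connected_setU1 cC rc.
- exact/nbhdS/subsetUr.
- by move=> v _ vr; apply/nbhdP; exists r; rewrite ?setU11.
- by rewrite cardsU1 addnC leq_add2l leq_b1.
- by apply: (adj_nbhd (setU11 r C)).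
Qed.

(** If [x] were adjacent to all neighbors of [r] outside [N C], it could join [C] in exchange for
    [r]. *)
Lemma attached_swap x r : attached x -> r \in R -> r \notin N C -> e x r ->
  exists2 u, u \notin N C & e r u && ~~ e x u.
Proof.
move=> ax rR rC xr; have [c cC xc] := attached_nbr ax.
have [/exists_inP[u uC ru]|none] :=
  boolP [exists u in [predC N C], e r u && ~~ e x u]; first by exists u.
exfalso; apply: (@no_swap (x |: C) r r rR) => //.
- exact: connected_setU1 cC xc.
- exact/nbhdS/subsetUr.
- move=> v vC vr; apply: (adj_nbhd (setU11 x C)); rewrite e_sym.
  case/orP: vr => [/eqP->//|vr]; apply: contraR none => xv.
  by apply/exists_inP; exists v => //; rewrite e_sym vr.
- by rewrite cardsU1 addnC leq_add2l leq_b1.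
- by apply: (adj_nbhd (setU11 x C)); rewrite e_sym.
Qed.

(** Let [r] in [R] dominate an outside neighbor [y] of [x]. If [x] misses [r], the path is x - y -
    r; otherwise it starts with x - r and [attached_swap] ends it. *)
Lemma attached_boundary x : attached x ->
  exists y u, [/\ y \notin N C, u \notin N C, e x y, e y u & ~~ e x u].
Proof.
move=> ax; have /attachedP[xC [y yC xy]] := ax.
have /nbhdP[r rR yr] := R_dom yC.
have rC := dominator_outside ax yC xy rR yr.
have [xr|xr] := boolP (e x r).
  by have [u uC /andP[ru xu]] := attached_swap ax rR rC xr; exists r, u.
exists y, r; split => //; case/orP: yr => // /eqP yr.
by rewrite -yr xy in xr.
Qed.

Lemma attached_complete x c' : attached x -> c' \in C -> e x c'.
Proof.
move=> ax c'C; apply/negPn/negP => xc'.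
have [c0 c0C xc0] := attached_nbr ax.
(* [C] lies within distance two of [x]: an edge c2 - w of [C] leaving [S] would give the forbidden
   path w - c2 - c1 - x - y - u. *)
have radius2 z : z \in C -> e x z \/ exists2 c, c \in C & e x c && e c z.
  pose S := [set z | e x z || [exists c in C, e x c && e c z]].
  have [y [u [yC uC xy yu xu]]] := attached_boundary ax.
  move=> zC; have [|zS] := boolP (z \in S).
    by rewrite inE => /orP[|/exists_inP]; [left|right].
  have c0S : c0 \in S by rewrite inE xc0.
  have [c2 [w [c2C c2S wC wS c2w]]] := connected_set_crossing C_conn c0C zC c0S zS.
  move: wS; rewrite inE negb_or => /andP[xw /exists_inPn nw].
  move: c2S; rewrite inE => /orP[xc2|/exists_inP[c1 c1C /andP[xc1 c12]]].
    by have := nw _ c2C; rewrite xc2 c2w.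
  have xc2: ~~ e x c2 by apply: contraTN c2w => xc2; have := nw _ c2C; rewrite xc2.
  have c1w: ~~ e c1 w by have := nw _ c1C; rewrite xc1.
  exfalso; apply: (@no_P6_C6 _ _ e_sym e_irr P6_free C6_free w c2 c1 x y u);
    solve [by rewrite // e_sym|exact: outside_adj].
have [//|[c cC /andP[xc cc']]] := radius2 c' c'C; first exact/negP.
(* The exchange keeps the size of [C], so [no_swap] still allows one more vertex. *)
pose C' := x |: (C :\ c').
have xC : x \notin C := attached_notin ax.
have inC' z : z \in C -> z != c' -> z \in C' by move=> zC zc'; rewrite !inE zC zc' orbT.
have neqc' z : e x z -> z != c' by apply: contraTneq => ->.
(* Connectivity survives since the middle vertices [c1] are adjacent to [x], hence differ from
   [c']. *)
have C'conn (Y : {set T}) : C' \subset Y ->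
    (forall z, z \in Y -> z \in C' \/ e x z) -> connected_set e Y.
  move=> /subsetP sub Yz; apply: (@connected_set_radius2 _ _ e_sym x).
    exact/sub/setU11.
  move=> z /Yz[|]; last by left.
  case/setU1P=> [->|/setD1P[_ zC] _]; first by rewrite eqxx.
  have [|[c1 c1C /andP[xc1 c1z]]] := radius2 z zC; [by left|right].
  by exists c1; rewrite ?xc1 //; apply/sub/inC'/neqc'.
have cardC' : #|C'| = #|C|.
  by rewrite cardsU1 [in RHS](cardsD1 c') c'C !inE negb_and xC orbT.
have xC' : x \in C' := setU11 _ _.
have yC' y : e x y -> y \in N C' by move=> xy; apply: (adj_nbhd xC'); rewrite e_sym.
(* Otherwise p - c' - c - x - y - u is an induced P_6 or C_6. *)
have lost p y u : p \in N C -> p \notin N C' -> y \notin N C -> u \notin N C ->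
    e x y -> e y u -> ~~ e x u -> e p y.
  move=> pC pC' yC uC xy yu xu; apply/negPn/negP => py.
  have pnadj z : z \in C' -> ~~ e p z by move=> zC'; apply: contra pC'; apply: adj_nbhd.
  have pc' : e p c'.
    case/nbhdP: pC => z zC /orP[/eqP pz|pz].
      have [zc'|zc'] := eqVneq z c'.
        by have := pnadj c (inC' _ cC (neqc' _ xc)); rewrite pz zc' e_sym cc'.
      by rewrite pz sub_nbhd ?inC' in pC'.
    have [<-//|zc'] := eqVneq z c'.
    by have := pnadj z (inC' _ zC zc'); rewrite pz.
  apply: (@no_P6_C6 _ _ e_sym e_irr P6_free C6_free p c' c x y u);
    solve [by []|by rewrite e_sym|exact: outside_adj
          |exact: pnadj|exact/pnadj/inC'/neqc'].
have /attachedP[_ [y0 y0C xy0]] := ax.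
have /nbhdP[r rR yr] := R_dom y0C.
have rC := dominator_outside ax y0C xy0 rR yr.
(* Each vertex lost by the exchange is adjacent to [y], so adding [y] to [C'] recovers all of
   [N C]. *)
have grow y u : y \notin N C -> u \notin N C -> e x y -> e y u -> ~~ e x u ->
    (forall v, v \notin N C -> (v == r) || e v r -> v \in N (y |: C')) -> False.
  move=> yC uC xy yu xu dom; have yY := setU11 y C'.
  apply: (@no_swap (y |: C') r y rR) => //.
  - apply: C'conn; first exact: subsetUr.
    by move=> z /setU1P[->|]; [right|left].
  - apply/subsetP => p pC; have [pC'|pC'] := boolP (p \in N C').
      exact: (subsetP (nbhdS _ (subsetUr _ _))) pC'.
    exact: adj_nbhd yY (lost _ _ _ pC pC' yC uC xy yu xu).
  - by rewrite cardsU1 cardC' addnC leq_add2l leq_b1.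
  - exact: sub_nbhd.
have [xr|xr] := boolP (e x r).
  have [u uC /andP[ru xu]] := attached_swap ax rR rC xr.
  by apply: (grow r u) => // v _ vr; apply/nbhdP; exists r; rewrite ?setU11.
have y0r : e y0 r by case/orP: yr => // /eqP yr; rewrite -yr xy0 in xr.
(* A neighbor [v] of [r] still uncovered ends the forbidden path c' - c - x - y0 - r - v. *)
apply: (grow y0 r) => // v vC vr; apply/negPn/negP => vY.
have vnadj z : z \in y0 |: C' -> ~~ e v z.
  by move=> zY; apply: contra vY; apply: adj_nbhd.
have vy0 := vnadj _ (setU11 _ _).
have {}vr : e v r by case/orP: vr => // /eqP vr; rewrite vr e_sym y0r in vy0.
apply: (@no_P6_C6 _ _ e_sym e_irr P6_free C6_free c' c x y0 r v);
  solve [by []|by rewrite e_sym|exact: outside_adj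
        |by rewrite e_sym vnadj // !inE eqxx ?orbT].
Qed.

(** * Rebuilding the pair from a dominating set [D] smaller than [k] *)

Variable D : {set T}.
Hypotheses (D_dom : forall v, v \in N D) (D_lt : #|D| < k).

Let Z := D :&: N C.

Let ZN z : z \in Z -> z \in N C.
Proof. exact: (subsetP (subsetIr _ _)). Qed.

Definition push x z :=
  if e x z || attached z then z else odflt z [pick c in C | e z c].

(** The last premise of [PushIn] ensures that [x] and [c] together dominate all that [z] did. *)
Variant push_spec x z : T -> Prop :=
  | PushAdj of e x z : push_spec x z z
  | PushAttached of attached z : push_spec x z z
  | PushIn c of c \in C & e x c & e z c &
      (forall w, e w z -> ~~ e x w -> w \in N [set c]) : push_spec x z c.

Lemma pushP x z : attached x -> z \in N C -> push_spec x z (push x z).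
Proof.
move=> ax zC; rewrite /push; case: ifPn => [/orP xz|].
  case: (boolP (e x z)) => [|nxz]; first exact: PushAdj.
  by apply: PushAttached; case: xz => //; rewrite (negbTE nxz).
rewrite negb_or => /andP[xz az]; case: pickP => [c /andP[cC zc]|none] /=; last first.
  (* The default of [push] is not reached: without a neighbor in [C], [z] lies in [C] and is
     adjacent to [x]. *)
  case/nbhdP: (zC) => c cC /orP[/eqP zc|zc]; last by have := none c; rewrite /= cC zc.
  by rewrite zc attached_complete in xz.
have xc := attached_complete ax cC; apply: PushIn => // w wz xw.
apply/negPn/negP => wN; have wc : ~~ e w c by apply: contra wN; apply/adj_nbhd/set11.
have [y [u [yC uC xy yu xu]]] := attached_boundary ax.
have zN v : v \notin N C -> ~~ e z v by exact: not_attached_adj.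
(* Neither [z] nor [w] has a neighbor outside [N C]: an attached [w] would be adjacent to [c]. *)
have wC : w \in N C by apply: contraLR wz => /zN; rewrite e_sym.
have wN' v : v \notin N C -> ~~ e w v.
  by apply: not_attached_adj wC _; apply: contra wc => aw; apply: attached_complete.
apply: (@no_P6_C6 _ _ e_sym e_irr P6_free C6_free w z c x y u);
  solve [by []|by rewrite e_sym|exact: zN|exact: wN'|exact: outside_adj].
Qed.

(** A dominator outside [N C] would make [v] attached. *)
Lemma unattached_dominated v : v \in N C -> ~~ attached v -> v \in N Z.
Proof.
move=> vC av; have /nbhdP[d dD vd] := D_dom v.
apply/nbhdP; exists d => //; rewrite inE dD.
case/orP: (vd) => [/eqP<-//|vd']; apply/negPn/negP => dC.
by have := not_attached_adj vC av dC; rewrite vd'.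
Qed.

(** The new pair is [C'] with [D :\: N C]. [E] links attached members of [Z] to [x]; the size bound
    allows it one vertex if [x] is in [Z] and none otherwise. Only attached vertices of [N C] may
    have all their dominators outside [N C], hence the last hypothesis. *)
Lemma push_contradiction x (E : {set T}) : attached x -> E \subset C ->
  #|E| + #|Z :\ x| <= #|Z| ->
  (forall z, z \in Z -> z != x -> attached z -> E != set0) ->
  (forall v, attached v -> v \in N (x |: (E :|: push x @: (Z :\ x)))) -> False.
Proof.
move=> ax /subsetP EC cardE EZ domA; set C' := x |: _ in domA.
have xC' : x \in C' := setU11 _ _.
have EC' c : c \in E -> c \in C' by move=> cE; rewrite !inE cE orbT.
have pC' z : z \in Z -> z != x -> push x z \in C'.
  by move=> zZ zx; apply/setU1r/setUP; right; apply: imset_f; apply/setD1P.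
have domZ v z : z \in Z -> (v == z) || e v z -> v \in N C'.
  move=> zZ vz; have [zx|zx] := eqVneq z x.
    by rewrite zx in vz; apply/nbhdP; exists x.
  have := pC' z zZ zx; have zC : z \in N C := ZN zZ.
  case: pushP => // [_ zC'|_ zC'|c cC xc zc near cC']; try by apply/nbhdP; exists z.
  case/orP: vz => [/eqP->|vz]; first exact: adj_nbhd zc.
  have [xv|xv] := boolP (e x v); first by apply: adj_nbhd xC' _; rewrite e_sym.
  by apply: (subsetP (nbhdS _ _)) (near v vz xv); rewrite sub1set.
have /attachedP[_ [y yC xy]] := ax.
apply: (@no_growth C' (D :\: N C) y) => //.
- apply: (@connected_set_radius2 _ _ e_sym x) => // z.
  case/setU1P=> [->|]; first by rewrite eqxx.
  case/setUP=> [zE _|/imsetP[t /setD1P[tx tZ] ->] _].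
    by left; apply: attached_complete (EC _ zE).
  have tC : t \in N C := ZN tZ.
  case: pushP => // [xt|at_|c _ xc _ _]; [by left|right|by left].
  have /set0Pn[c cE] := EZ t tZ tx at_; have cC := EC _ cE.
  by exists c; rewrite ?EC' // attached_complete // e_sym attached_complete.
- apply/subsetP => v vC; have [/domA//|av] := boolP (attached v).
  by have /nbhdP[z zZ vz] := unattached_dominated vC av; apply: domZ vz.
- move=> v vC'; have /nbhdP[d dD vd] := D_dom v.
  apply/nbhdP; exists d => //; rewrite inE dD andbT.
  by apply: contra vC' => dC; apply: domZ vd; rewrite inE dD.
- apply: leq_trans D_lt; rewrite -(cardsID (N C) D) -addSn leq_add2r.
  rewrite cardsU1 -add1n leq_add ?leq_b1 //; apply: leq_trans cardE.
  by apply: leq_trans (leq_card_setU _ _) _; rewrite leq_add2l leq_imset_card.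
- by apply: adj_nbhd xC' _; rewrite e_sym.
Qed.

Lemma no_attached x : ~~ attached x.
Proof.
apply/negP => ax; have /set0Pn[c cC] := C_neq0.
(* An attached [t] in [Z] serves as [x] at no cost, so one vertex [c] of [C] is affordable, and it
   covers all attached vertices. *)
have [/exists_inP[t tZ at_]|/exists_inPn naZ] := boolP [exists t in Z, attached t].
  apply: (@push_contradiction t [set c]) => //; first by rewrite sub1set.
  - by rewrite cards1 (cardsD1 t Z) tZ.
  - by move=> *; apply/set0Pn; exists c; rewrite set11.
  - move=> v av; apply: (@adj_nbhd _ _ _ v c); last exact: attached_complete.
    by rewrite !inE eqxx orbT.
have noZ t : attached t -> t \notin Z by move=> at_; apply/negP => /naZ; rewrite at_.
have ZD1 t : attached t -> Z :\ t = Z.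
  by move=> at_; apply/setDidPl; rewrite disjoint_sym disjoints1 noZ.
(* Now some pushed vertex must itself cover all attached vertices. If an attached [t] misses some
   [z], that [z] is pushed into [C]; otherwise any [z] in [Z] is adjacent to all of them. *)
have [t at_ [z zZ zt]] : exists2 t, attached t &
    exists2 z, z \in Z & forall v, attached v -> e v (push t z).
  have [/existsP[t /andP[at_ /exists_inP[z zZ tz]]]|all_adj] :=
    boolP [exists t, attached t && [exists z in Z, ~~ e t z]].
    exists t => //; exists z => // v av; have zC : z \in N C := ZN zZ.
    case: pushP => // [tz'|az|c' c'C _ _ _]; last exact: attached_complete.
      by rewrite tz' in tz.
    by have := naZ z zZ; rewrite az.
  have adj t z : attached t -> z \in Z -> e t z.
    move=> at_ zZ; apply: contraR all_adj => tz.
    by apply/existsP; exists t; rewrite at_; apply/exists_inP; exists z.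
  (* [Z] is nonempty since it dominates the unattached [c]. *)
  have ac : ~~ attached c by apply: contraL cC => /attached_notin.
  have /nbhdP[z zZ _] := unattached_dominated (sub_nbhd e cC) ac.
  by exists x => //; exists z => // v av; rewrite /push adj //= adj.
apply: (@push_contradiction t set0) => //; first exact: sub0set.
- by rewrite cards0 ZD1.
- by move=> s /naZ/negP.
- move=> v /zt; apply: adj_nbhd.
  by apply/setU1r/setUP; right; apply: imset_f; rewrite ZD1.
Qed.

(** By connectedness of the graph an edge would leave [N C], and its inner end would be attached. *)
Lemma max_pair_dominating : N C = setT.
Proof.
apply/setP => b; rewrite in_setT; apply/negPn/negP => bC.
have /set0Pn[a aC] := C_neq0.
have [x [y [_ xC _ yC xy]]] :=
  connected_set_crossing e_conn (in_setT a) (in_setT b) (sub_nbhd e aC) bC.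
by have /attachedP[] := no_attached x; split => //; exists y.
Qed.

End MaximalPair.

Theorem theorem2 (T : finType) (e : rel T)
  (e_sym : symmetric e) (e_irr : irreflexive e)
  (e_conn : connected_graph e)
  (P6_free : induced_free (@path_rel 6) e)
  (C6_free : induced_free (@cycle_rel 6) e) :
  gamma_c e <= gamma e + 1.
Proof.
have [[D domD cardD] _] := gammaP e; have [_ min_c] := gamma_cP e_conn.
have ND v : v \in nbhd e D.
  by move: domD; rewrite dominating_nbhd => /eqP->; rewrite inE.
(* The empty graph has no starting pair; there the empty set serves. *)
have [x0 _|T0] := pickP (predT : pred T); last first.
  apply: leq_trans (min_c set0 _) _; last by rewrite cards0.
  by apply/andP; split; apply/forallP => x; have := T0 x.
pose good (p : {set T} * {set T}) := [&& connected_set e p.1, p.1 != set0,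
  [forall v, (v \notin nbhd e p.1) ==> (v \in nbhd e p.2)]
  & #|p.1| + #|p.2| <= gamma e + 1].
(* [D] alone dominates everything, and [x0] uses up the extra one in the bound. *)
have good0 : good ([set x0], D).
  rewrite /good /= connected_set1 //= cards1 addnC cardD leqnn andbT.
  apply/andP; split; first by apply/set0Pn; exists x0; rewrite set11.
  by apply/forallP => v; rewrite ND implybT.
case: (@arg_maxnP _ ([set x0], D) good (fun p => #|nbhd e p.1|) good0) => -[C R].
case/and4P=> /= C_conn C_neq0 /forallP R_dom CR_le maxC.
have NC : nbhd e C = setT.
  apply: (max_pair_dominating e_sym e_irr e_conn P6_free C6_free
    C_conn C_neq0 _ CR_le _ ND).
  - by move=> v; apply/implyP.
  - move=> C' R' conn' dom' le' sub.
    (* An empty [C'] is not [good], but its neighborhood is empty. *)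
    have [C'0|C'n0] := eqVneq C' set0.
      by apply/subsetP => v /nbhdP[y]; rewrite C'0 inE.
    have : good (C', R').
      by rewrite /good /= conn' C'n0 le' andbT; apply/forallP => v; apply/implyP/dom'.
    by move/maxC => /= le; have /eqP<- : nbhd e C == nbhd e C' by rewrite eqEcard sub.
  - by rewrite cardD addn1.
apply: leq_trans (min_c C _) (leq_trans (leq_addr _ _) CR_le).
by rewrite /connected_dominating dominating_nbhd NC eqxx.
Qed.
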